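(* For every compact subset $\mathbf{A}$ of $\mathbb{R}^{n\times n}$, let $S_{\mathbf{A}}$ be the switched system $$\dot x(t)=A(t)x(t),\qquad x\in\mathbb{R}^n,\quad A(\cdot):[0,\infty[\to\mathbf{A}\ \text{measurable}.$$ Let $\mathbf{A}$ and $\mathbf{A}'$ be compact subsets of $\mathbb{R}^{n\times n}$ generating the same convex semicone. Then $S_{\mathbf{A}}$ is globally uniformly exponentially stable (GUES) if and only if $S_{\mathbf{A}'}$ is GUES; and $S_{\mathbf{A}}$ is uniformly stable if and only if $S_{\mathbf{A}'}$ is uniformly stable.
   Context: The convex semicone generated by a set $D$ in a real vector space is $\{\lambda x:\ \lambda>0,\ x\in co(D)\}$, where $co(D)$ denotes the convex hull of $D$. Let $\phi^{A(\cdot)}_t(x_0)$ denote the value at time $t\ge0$ of the (Carathéodory) solution of $\dot x(t)=A(t)x(t)$, $x(0)=x_0$. Uniformly stable: for every $\varepsilon>0$ there exists $\delta>0$ such that $\|\phi^{A(\cdot)}_t(x_0)\|\le\varepsilon$ for every $t\ge0$, every $\|x_0\|\le\delta$ and every measurable switching function $A(\cdot)$. GUES: there exist $M,\lambda>0$ such that $\|\phi^{A(\cdot)}_t(x_0)\|\le Me^{-\lambda t}\|x_0\|$ for every $x_0\in\mathbb{R}^n$, $t>0$ and every measurable switching function $A(\cdot)$. *)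

(* Defs.v *)
From mathcomp Require Import all_boot all_order all_algebra.
From mathcomp Require Import all_classical all_reals all_analysis.
From mathcomp Require Import measurable_realfun.

Set Implicit Arguments.
Unset Strict Implicit.
Unset Printing Implicit Defensive.
Import Order.TTheory GRing.Theory Num.Theory.
Import numFieldNormedType.Exports.
Local Open Scope classical_set_scope.
Local Open Scope ring_scope.

Definition convex_hull (R : realType) (V : lmodType R) (D : set V) : set V :=
  smallest (@convex_set R V) D.

Definition convex_semicone (R : realType) (V : lmodType R) (D : set V) :
    set V :=
  [set y | exists2 l : R, 0 < l & exists2 x, convex_hull D x & y = l *: x].

Definition enorm (R : realType) (n : nat) (x : 'cV[R]_n) : R :=
  Num.sqrt (\sum_(i < n) x i 0 ^+ 2).

Definition absolutely_continuous (R : realType) (V : normedModType R)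
    (a b : R) (f : R -> V) : Prop :=
  forall e : R, 0 < e -> exists2 d : R, 0 < d &
    forall (k : nat) (u v : 'I_k -> R),
      (forall i, a <= u i /\ u i <= v i /\ v i <= b) ->
      trivIset setT (fun i => `]u i, v i[%classic) ->
      \sum_(i < k) (v i - u i) < d ->
      \sum_(i < k) `|f (v i) - f (u i)| < e.

(* The real line with the sigma-algebra of Lebesgue measurable sets, i.e. the
   completion of the Borel one. *)
Definition lebesgueR (R : realType) : Type :=
  g_sigma_algebraType (completed_algebra_gen (@lebesgue_measure R)).

(* Switching functions and trajectories are total on R; only their values at
   times t >= 0 are constrained or used. *)
Definition switching_function (R : realType) (n : nat) (A : set 'M[R]_n)
    (a : R -> 'M[R]_n) : Prop :=
  (forall t, 0 <= t -> A (a t)) /\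
  (forall i j,
     measurable_fun (`[0, +oo[%classic : set (lebesgueR R)) (fun t => a t i j)).

Definition caratheodory_solution (R : realType) (n : nat) (a : R -> 'M[R]_n)
    (x0 : 'cV[R]_n) (x : R -> 'cV[R]_n) : Prop :=
  [/\ x 0 = x0,
      forall T, 0 <= T -> absolutely_continuous 0 T x &
      {ae @lebesgue_measure R,
        forall t : R, 0 < t -> is_derive t 1 x (a t *m x t)}].

(* The linear Cauchy problem with a bounded measurable coefficient has exactly
   one Caratheodory solution, so the flow value at time t from x0 is rendered
   below as x t for the solution x starting at x0. *)
Definition uniformly_stable (R : realType) (n : nat) (A : set 'M[R]_n) : Prop :=
  forall e : R, 0 < e -> exists2 d : R, 0 < d &
    forall (t : R) (x0 : 'cV[R]_n) (a : R -> 'M[R]_n) (x : R -> 'cV[R]_n),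
      0 <= t -> enorm x0 <= d -> switching_function A a ->
      caratheodory_solution a x0 x -> enorm (x t) <= e.

Definition GUES (R : realType) (n : nat) (A : set 'M[R]_n) : Prop :=
  exists M lam : R, [/\ 0 < M, 0 < lam &
    forall (x0 : 'cV[R]_n) (t : R) (a : R -> 'M[R]_n) (x : R -> 'cV[R]_n),
      0 < t -> switching_function A a -> caratheodory_solution a x0 x ->
      enorm (x t) <= M * expR (- lam * t) * enorm x0].

(* Main.v *)
Require Import Defs.
From mathcomp Require Import all_boot all_order all_algebra.
From mathcomp Require Import all_classical all_reals all_analysis.
From mathcomp Require Import measurable_realfun lra ring.
Import numFieldNormedType.Exports.
Set Implicit Arguments.
Unset Strict Implicit.
Unset Printing Implicit Defensive.
Import Order.TTheory GRing.Theory Num.Theory.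
Local Open Scope classical_set_scope.
Local Open Scope ring_scope.

(* Stability of A with rate lam >= 0 makes V x, the supremum of
   expR (lam * T) * |P x| over the finite products P of factors expmx B h
   (B in A, h > 0) of total duration T, a seminorm equivalent to the norm, and
   the one-sided derivative V'(x; (B + lam) x) is nonpositive for B in A.  Since
   V'(x; .) is sublinear, the matrices B with V'(x; B x) <= 0 for all x form a
   convex cone, so l C + l lam lies in it for every l C in the semicone.  If
   y' = B y almost everywhere with B in this cone and y absolutely continuous,
   then V o y is nonincreasing; with y t = expR (k t) x t this gives decay at
   rate k for the trajectories of A'.  For uniform stability lam = k = 0 and the
   scaling factors l need not be controlled; for exponential stability l is
   bounded below because A' is compact without 0 and A is bounded.  No existence
   theory for measurable coefficients is needed, only piecewise constant
   switching. *)

(** * Absolutely continuous functions with nonpositive slopes *)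

Lemma negligible_open_cover (R : realType) (N : set R) (d : R) :
  (@lebesgue_measure R).-negligible N -> 0 < d ->
  exists U : set R, [/\ open U, N `<=` U & (lebesgue_measure U < d%:E)%E].
Proof.
move=> [M [mM M0 NM]] d0.
have [] := @lebesgue_regularity_outer R M d mM _ d0.
  by rewrite [X in (X < _)%E]M0.
move=> U [oU MU Ud]; exists U; split=> //; first exact: subset_trans MU.
have mU : measurable U by exact: open_measurable.
rewrite -(setDUK MU) measureU//; last 2 first.
- exact: measurableD.
- by rewrite setDE setICA setICr setI0.
by rewrite [X in (X + _)%E]M0 add0e.
Qed.

Lemma sum_length_le_measure (R : realType) (U : set R) (k : nat)
    (u v : 'I_k -> R) :
  measurable U -> (forall i, u i <= v i) ->
  trivIset setT (fun i => `]u i, v i[%classic) ->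
  (forall i, `]u i, v i[ `<=` U) ->
  ((\sum_(i < k) (v i - u i))%:E <= lebesgue_measure U)%E.
Proof.
move=> mU uv tuv uvU.
rewrite -sumEFin.
under eq_bigr => i _.
  have -> : (v i - u i)%:E = (@lebesgue_measure R) `]u i, v i[.
    rewrite lebesgue_measure_itv/= lte_fin; case: ifPn => [//|].
    by rewrite -leNgt => vu; congr EFin; have := uv i; lra.
  over.
rewrite -(@measure_bigsetU_ord _ _ _ (@lebesgue_measure R) k xpredT
  (fun i => `]u i, v i[%classic))//.
apply: le_measure; rewrite ?inE//.
  by apply: bigsetU_measurable.
by elim/big_ind: _ => // X Y XU YU; rewrite subUset.
Qed.

Section AbsolutelyContinuousMonotone.
Variables (R : realType) (f : R -> R) (T e : R) (U : set R).

(* [U] is a small open neighbourhood of the exceptional times: up to time [t],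
   [f] has slope at most [e] except on disjoint subintervals of [U]. *)
Let covered (t : R) := exists (k : nat) (u v : 'I_k -> R),
  [/\ forall i, 0 <= u i /\ u i <= v i /\ v i <= t,
      trivIset setT (fun i => `]u i, v i[%classic),
      forall i, `]u i, v i[ `<=` U &
      f t - f 0 <= e * t + \sum_(i < k) (f (v i) - f (u i))].

(** The family of intervals is kept; the slope bound is absorbed by the linear term. *)
Lemma covered_slope s s' : s <= s' -> f s' - f s <= e * (s' - s) ->
  covered s -> covered s'.
Proof.
move=> ss' fss' [k [u [v [uv tuv uvU fs]]]]; exists k, u, v; split=> //.
- by move=> i; have [? [? ?]] := uv i; repeat split=> //; lra.
- by rewrite mulrBr in fss'; lra.
Qed.

(** The interval from [s] to [s'] joins the family under the last index, so the increment of [f]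
    over it is counted exactly in the sum. *)
Lemma covered_interval s s' : 0 <= e -> 0 <= s -> s <= s' ->
  `]s, s'[ `<=` U -> covered s -> covered s'.
Proof.
move=> e0 s0 ss' ssU [k [u [v [uv tuv uvU fs]]]].
pose ext (w : 'I_k -> R) (r : R) (i : 'I_k.+1) :=
  if unlift ord_max i is Some j then w j else r.
have extl w r (j : 'I_k) : ext w r (lift ord_max j) = w j.
  by rewrite /ext liftK.
have extm w r : ext w r ord_max = r by rewrite /ext unlift_none.
exists k.+1, (ext u s), (ext v s'); split.
- move=> i; case: (unliftP ord_max i) => [j|] ->; rewrite ?extl ?extm.
    by have [? [? ?]] := uv j; repeat split=> //; lra.
  by repeat split.
- have sep j x : `]u j, v j[%classic x -> `]s, s'[%classic x -> False.
    rewrite /= !in_itv/= => /andP[_ xv] /andP[sx _].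
    by have [_ [_ vs]] := uv j; lra.
  move=> i j _ _; case: (unliftP ord_max i) => [i'|] ->;
    case: (unliftP ord_max j) => [j'|] ->; rewrite ?extl ?extm => -[x [xi xj]].
  + by congr lift; apply: tuv => //; exists x.
  + by case: (sep _ _ xi xj).
  + by case: (sep _ _ xj xi).
  + by [].
- by move=> i; case: (unliftP ord_max i) => [j|] ->; rewrite ?extl ?extm.
- rewrite big_ord_recr/= !extm.
  under eq_bigr => i _.
    have -> : widen_ord (leqnSn k) i = lift ord_max i.
      by apply: val_inj; rewrite /= /bump leqNgt ltn_ord.
    rewrite !extl; over.
  have : e * s <= e * s' by exact: ler_wpM2l.
  by rewrite /=; lra.
Qed.

(** Supremum argument: let [c] be the supremum of the covered times. The gauge at [c] admits
    intervals straddling [c], so a covered [s] close to [c] makes [min (c + r / 2) T] covered. This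
    time cannot exceed [c], hence it is [T]. *)
Lemma covered_total : 0 <= e -> 0 <= T ->
  (forall t, 0 <= t <= T -> exists2 r, 0 < r &
    forall s s', 0 <= s -> s' <= T -> t - r < s -> s <= t -> t <= s' ->
      s' < t + r -> f s' - f s <= e * (s' - s) \/ `]s, s'[ `<=` U) ->
  covered T.
Proof.
move=> e0 T0 gauge.
pose S := [set t | 0 <= t <= T /\ covered t].
have S0 : S 0.
  split; first by rewrite lexx T0.
  exists 0, (fun=> 0), (fun=> 0); split => //.
  - by case.
  - by case.
  - by rewrite big_ord0; lra.
have Sub : ubound S T by move=> t [/andP[]].
have hS : has_sup S by split; [exists 0|exists T].
pose c := sup S.
have c0 : 0 <= c by apply: ub_le_sup => //; exists T.
have cT : c <= T by apply: ge_sup => //; exists 0.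
have [|r r0 gc] := gauge c; first by rewrite c0 cT.
have [s [/andP[s0 sT] cs] crs] := sup_adherent r0 hS.
rewrite -/c in crs.
have sc : s <= c by apply: ub_le_sup; [exists T|split => //; rewrite s0 sT].
pose s' := Order.min (c + r / 2) T.
have cs' : c <= s' by rewrite /s' le_min cT andbT; lra.
have s'T : s' <= T by rewrite /s' ge_min lexx orbT.
have s'r : s' < c + r.
  by apply: (@le_lt_trans _ _ (c + r / 2)); [rewrite /s' ge_min lexx|lra].
have cs1 : covered s'.
  have [h|h] := gc s s' s0 s'T crs sc cs' s'r.
  - by apply: covered_slope cs => //; lra.
  - by apply: covered_interval cs => //; lra.
have : s' <= c.
  apply: ub_le_sup; [by exists T|split => //].
  by rewrite s'T andbT; lra.
have [h|h] := leP (c + r / 2) T.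
  by rewrite /s' (min_idPl h); lra.
by rewrite /s' (min_idPr (ltW h)) in cs1 *.
Qed.

End AbsolutelyContinuousMonotone.

(** Each time outside [N] has a gauge where the slope is at most [e]; each time in [N] has one
    inside an open set [U] so small that, by absolute continuity, the increments over disjoint
    intervals of [U] add up to less than [e]. *)
Lemma absolutely_continuous_nonincreasing (R : realType) (f : R -> R) (T : R)
    (N : set R) :
  0 <= T -> absolutely_continuous 0 T (f : R -> R^o) ->
  (@lebesgue_measure R).-negligible N ->
  (forall t e, 0 <= t <= T -> ~ N t -> 0 < e -> exists2 r, 0 < r &
    forall s s', t - r < s -> s <= t -> t <= s' -> s' < t + r ->
      f s' - f s <= e * (s' - s)) ->
  f T <= f 0.
Proof.
move=> T0 acf nN slope.
apply/ler_addgt0Pr => e0 e00.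
(* The slopes contribute [e * T] and the intervals in [U] contribute [e], in total [e0]. *)
pose e := e0 / (T + 1).
have T1 : 0 < T + 1 by lra.
have e_gt0 : 0 < e by rewrite divr_gt0.
have [d d0 acd] := acf e e_gt0.
have [U [oU NU Ud]] := negligible_open_cover nN d0.
have [|k [u [v [uv tuv uvU fT]]]] := @covered_total R f T e U (ltW e_gt0) T0.
  move=> t tT; have [Nt|Nt] := pselect (N t); last first.
    have [r r0 h] := slope t e tT Nt e_gt0.
    by exists r => // s s' _ _ *; left; apply: h.
  have /nbhs_ballP[r /= r0 rU] : nbhs t U by apply: open_nbhs_nbhs; split; [|exact: NU].
  exists r => // s s' _ _ ts st ts' s't; right => x; rewrite /= in_itv/= => /andP[sx xs'].
  by apply: rU; rewrite -ball_normE/= ltr_norml; apply/andP; split; lra.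
have small : \sum_(i < k) `|f (v i) - f (u i)| < e.
  apply: (acd k u v) => //.
  rewrite -lte_fin; apply: le_lt_trans Ud.
  apply: sum_length_le_measure => //; first exact: open_measurable.
  by move=> i; have [_ []] := uv i.
have le1 : \sum_(i < k) (f (v i) - f (u i)) <= \sum_(i < k) `|f (v i) - f (u i)|.
  by apply: ler_sum => i _; exact: ler_norm.
have -> : e0 = e * T + e by rewrite -[X in _ + X]mulr1 -mulrDr /e divfK// gt_eqF.
lra.
Qed.

(** * The matrix exponential *)

Lemma is_derive_mxP (R : realType) (m n : nat) (M : R -> 'M[R]_(m, n))
    (t : R) (D : 'M[R]_(m, n)) :
  (forall i j, is_derive t 1 (fun s => M s i j : R^o) (D i j)) <->
  is_derive t 1 M D.
Proof.
split=> [dM|dM i j].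
- have dvM : derivable M t 1 by apply/derivable_mxP => i j; have [] := dM i j.
  apply: DeriveDef => //; rewrite derive_mx//.
  by apply/matrixP => i j; rewrite mxE; have [_ ->] := dM i j.
- have [dvM <-] := dM.
  rewrite derive_mx// mxE; apply: derivableP.
  by move/derivable_mxP : dvM; exact.
Qed.

Lemma mx_entry_norm (R : realType) (m n : nat) (M : 'M[R]_(m, n)) i j :
  `|M i j| <= `|M|.
Proof.
by rewrite [leRHS]/Num.Def.normr/= mx_normrE; exact: (le_bigmax _ _ (i, j)).
Qed.

Lemma mx_norm_le (R : realType) (m n : nat) (M : 'M[R]_(m, n)) (c : R) :
  0 <= c -> (forall i j, `|M i j| <= c) -> `|M| <= c.
Proof.
move=> c0 Mc; rewrite [leLHS]/Num.Def.normr/= mx_normrE.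
by apply: bigmax_le => // i _; exact: Mc.
Qed.

Lemma mx_norm_mulmx (R : realType) (m n p : nat) (M : 'M[R]_(m, n))
    (N : 'M[R]_(n, p)) : `|M *m N| <= n%:R * `|M| * `|N|.
Proof.
apply: mx_norm_le => [|i j]; first by rewrite !mulr_ge0.
rewrite mxE (le_trans (ler_norm_sum _ _ _))//.
rewrite -mulrA -[n in n%:R]card_ord mulr_natl -sumr_const ler_sum// => k _.
by rewrite normrM ler_pM// mx_entry_norm.
Qed.

Section MatrixExponential.
Variables (R : realType) (n : nat) (B : 'M[R]_n).

(** The exponential of [t *: B], encoded entrywise as scalar power series in [t], which can be
    differentiated term by term. *)
Definition expmx (t : R) : 'M[R]_n :=
  \matrix_(i, j) limn (pseries (fun k => (B ^+ k) i j / k`!%:R) t).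

Lemma exprmx_entry_norm k i j :
  `|(B ^+ k) i j| <= (n%:R * `|B|) ^+ k.
Proof.
elim: k i j => [|k ih] i j.
  by rewrite !expr0 mxE; case: (i == j); rewrite ?normr1 ?normr0.
rewrite exprS mxE (le_trans (ler_norm_sum _ _ _))//.
rewrite exprS -mulrA -[n in n%:R]card_ord mulr_natl -sumr_const ler_sum// => l _.
by rewrite normrM ler_pM// ?card_ord ?mx_entry_norm// ih.
Qed.

(** Comparison with [b ^+ m] times the exponential series at [b * |t|]. The shift [m] covers the
    termwise derivatives of the series of [expmx]. *)
Lemma is_cvg_pseries_expmx m i j t :
  cvgn (pseries (fun k => (B ^+ (k + m)) i j / k`!%:R) t).
Proof.
pose b : R := n%:R * `|B|.
apply: normed_cvg.
apply: (@series_le_cvg _ _ (b ^+ m *: exp_coeff (b * `|t|))) => [k|k|k|] /=.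
- exact: normr_ge0.
- by rewrite /exp_coeff /= !mulr_ge0// ?invr_ge0// exprn_ge0 ?mulr_ge0.
- rewrite !normrM normfV normr_nat normrX /exp_coeff /=.
  have -> : (b ^+ m *: exp_coeff (b * `|t|)) k =
      b ^+ (k + m) * k`!%:R^-1 * `|t| ^+ k.
    transitivity (b ^+ m * ((b * `|t|) ^+ k / k`!%:R)) => //.
    by rewrite [in LHS](exprMn _ b) exprD; ring.
  by rewrite ler_wpM2r ?exprn_ge0// ler_wpM2r ?invr_ge0// exprmx_entry_norm.
- apply: is_cvg_seriesZ; exact: is_cvg_series_exp_coeff.
Qed.

Lemma expmx0 : expmx 0 = 1%:M.
Proof.
apply/matrixP => i j; rewrite mxE.
apply: cvg_lim => //; apply: cvg_near_cst.
near=> k; rewrite /pseries /series /=.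
have -> : k = k.-1.+1 by rewrite prednK//; near: k; exists 1%N.
rewrite big_nat_recl//= big1 => [|l _]; last by rewrite expr0n/= mulr0.
by rewrite expr0 fact0 divr1 mulr1 addr0.
Unshelve. all: by end_near. Qed.

Lemma is_derive_expmx (t : R) : is_derive t 1 expmx (B *m expmx t).
Proof.
apply/is_derive_mxP => i j.
pose c m := fun k => (B ^+ (k + m)) i j / k`!%:R.
have diffs_c m : pseries_diffs (c m) = c m.+1.
  apply/funext => k; rewrite /pseries_diffs /c addnS factS natrM invfM.
  by rewrite mulrCA mulVKf.
rewrite (_ : (fun s => _) = (fun s => limn (pseries (c 0) s))); last first.
  by apply/funext => s; rewrite mxE; congr (limn (pseries _ _));
     apply/funext => k; rewrite /c addn0.
(* The derived series is [B] times the original one, since [B ^+ k.+1 = B * B ^+ k]. *)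
have -> : (B *m expmx t) i j = limn (pseries (pseries_diffs (c 0)) t).
  apply/esym/cvg_lim => //; rewrite diffs_c.
  have -> : pseries (c 1) t =
      fun N => \sum_l B i l * pseries (fun k => (B ^+ k) l j / k`!%:R) t N.
    apply/funext => N; rewrite /pseries /series/=.
    under [RHS]eq_bigr do rewrite mulr_sumr.
    rewrite exchange_big/=; apply: eq_bigr => k _.
    rewrite /c addn1 exprS mxE mulrAC -!mulrA mulr_suml.
    by apply: eq_bigr => l _; rewrite mulrA; ring.
  rewrite mxE; apply: cvg_big => [|l _]; first exact: add_continuous.
  rewrite mxE; apply: cvgMr.
  have := @is_cvg_pseries_expmx 0 l j t.
  by under eq_fun do rewrite addn0.
(* The series and its first two termwise derivatives must converge at a point beyond [t]. *)
apply: (@pseries_snd_diffs _ _ (`|t| + 1)); rewrite ?diffs_c.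
- exact: is_cvg_pseries_expmx.
- exact: is_cvg_pseries_expmx.
- exact: is_cvg_pseries_expmx.
- by rewrite [ltRHS]ger0_norm// ltrDl.
Qed.

End MatrixExponential.

(** * Piecewise constant switching *)

Lemma is_derive_translate (R : realType) (V : normedModType R) (f : R -> V)
    (c t : R) (df : V) :
  is_derive (t - c) 1 f df -> is_derive t 1 (fun s => f (s - c)) df.
Proof.
move=> [dvf <-].
have E : (fun h : R => h^-1 *: (f (h *: (1 : R) + t - c) - f (t - c))) =
    (fun h : R => h^-1 *: (f (h *: (1 : R) + (t - c)) - f (t - c))).
  by apply/funext => h; rewrite addrA.
by apply: DeriveDef; [rewrite /derivable/= E|rewrite /derive/= E].
Qed.

Lemma is_derive_mulmx_cst (R : realType) (m n p : nat) (M : R -> 'M[R]_(m, n))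
    (N : 'M[R]_(n, p)) (t : R) (D : 'M[R]_(m, n)) :
  is_derive t 1 M D -> is_derive t 1 (fun s => M s *m N) (D *m N).
Proof.
move=> /is_derive_mxP dM; apply/is_derive_mxP => i j.
have := @is_derive_sum _ _ _ n (fun k s => N k j *: (M s i k : R^o)) t 1
  (fun k => N k j *: D i k) (fun k => is_deriveZ _ (dM i k)).
rewrite (_ : (fun s => _) = \sum_k (fun s => N k j *: (M s i k : R^o))).
  rewrite mxE; under [X in is_derive _ _ _ X -> _]eq_bigr => k _.
    have -> : N k j *: (D i k : R^o) = D i k * N k j by exact: mulrC.
    over.
  by [].
apply/funext => s; rewrite mxE fct_sumE.
by apply: eq_bigr => k _; rewrite mulrC.
Qed.

(** Stronger than absolute continuity on each segment from 0, and easy to glue at a switching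
    time. *)
Definition lipschitz_on_segments (R : realType) (V : normedModType R)
    (x : R -> V) : Prop :=
  forall T : R, exists2 C : R, 0 <= C &
    forall u v : R, 0 <= u -> u <= v -> v <= T -> `|x v - x u| <= C * (v - u).

(** The derivative [B *m y t] is bounded on the compact segment; the mean value theorem is then
    applied to each entry. *)
Lemma linear_flow_lipschitz (R : realType) (n : nat) (B : 'M[R]_n)
    (y : R -> 'cV[R]_n) :
  (forall t : R, is_derive t 1 y (B *m y t)) -> lipschitz_on_segments y.
Proof.
move=> dy T.
have cty : continuous y.
  move=> t; apply/differentiable_continuous/derivable1_diffP.
  by have [] := dy t.
have [T0|T0] := ltP T 0.
  by exists 0 => // u v u0 uv vT; lra.
have [|c _ maxc] := @EVT_max R (fun t => `|y t|) 0 T T0.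
  by apply: continuous_subspaceT => t; apply: cvg_norm; exact: cty.
exists (n%:R * `|B| * `|y c|); first by rewrite !mulr_ge0.
move=> u v u0 uv vT; apply: mx_norm_le => [|i j].
  by rewrite !mulr_ge0// subr_ge0.
have dyij (t : R) : is_derive t 1 (fun s => y s i j : R^o) ((B *m y t) i j).
  by have /is_derive_mxP := dy t.
have [|s sin Es] := @MVT_segment R (fun s => y s i j) (fun s => (B *m y s) i j)
    u v uv (fun s _ => dyij s).
  apply: continuous_subspaceT => t.
  by apply/differentiable_continuous/derivable1_diffP; have [] := dyij t.
rewrite !mxE Es normrM (ger0_norm (_ : 0 <= v - u)) ?subr_ge0//.
rewrite ler_wpM2r ?subr_ge0// (le_trans (mx_entry_norm _ _ _))//.
rewrite (le_trans (mx_norm_mulmx _ _))// ler_wpM2l ?mulr_ge0// maxc//.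
by move: sin; rewrite !in_itv/= => /andP[us sv]; apply/andP; split; lra.
Qed.

Lemma lipschitz_absolutely_continuous (R : realType) (V : normedModType R)
    (x : R -> V) (T : R) :
  lipschitz_on_segments x -> absolutely_continuous 0 T x.
Proof.
move=> /(_ T)[C C0 lx] e e0.
have C1 : 0 < C + 1 by lra.
exists (e / (C + 1)); first by rewrite divr_gt0.
move=> k u v uv _ suv.
apply: (@le_lt_trans _ _ (\sum_(i < k) C * (v i - u i))).
  by apply: ler_sum => i _; have [? [? ?]] := uv i; exact: lx.
rewrite -mulr_sumr.
have s0 : 0 <= \sum_(i < k) (v i - u i).
  by apply: sumr_ge0 => i _; have [? [? ?]] := uv i; rewrite subr_ge0.
rewrite ltr_pdivlMr// in suv.
by nra.
Qed.

Lemma lebesgueR_measurable_itv (R : realType) (i : interval R) :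
  measurable ([set` i] : set (lebesgueR R)).
Proof.
apply: sub_sigma_algebra; exists [set` i]; first exact: measurable_itv.
by exists set0; [exact: negligible_set0|rewrite setU0].
Qed.

Lemma switching_function_cst (R : realType) (n : nat) (A : set 'M[R]_n)
    (B : 'M[R]_n) : A B -> switching_function A (fun=> B).
Proof.
by move=> AB; split=> // i j; apply: measurable_cst.
Qed.

Lemma switching_function_if (R : realType) (n : nat) (A : set 'M[R]_n)
    (B : 'M[R]_n) (a : R -> 'M[R]_n) (T : R) :
  A B -> switching_function A a ->
  switching_function A (fun t => if t < T then a t else B).
Proof.
move=> AB [Aa ma]; split=> [t t0|i j]; first by case: ifP => // _; exact: Aa.
have mD : measurable (`[0, +oo[%classic : set (lebesgueR R)).
  exact: lebesgueR_measurable_itv.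
rewrite (_ : (fun t => _) = fun t => if t < T then a t i j else B i j); last first.
  by apply/funext => t; case: ifP.
apply: (@measurable_fun_if _ _ _ _ (fun t : lebesgueR R => a t i j)
   (fun=> B i j) _ mD (fun t => t < T)).
- apply: (@measurable_fun_bool _ _ _ _ true).
  rewrite (_ : _ `&` _ = `[0, T[%classic); first exact: lebesgueR_measurable_itv.
  apply/seteqP; split=> t /=; rewrite !in_itv/= andbT.
    by move=> [-> ->].
  by move=> /andP[-> ->].
- exact: (measurable_funS mD (@subIsetl _ _ _) (ma i j)).
- exact: measurable_cst.
Qed.

(** The finitely many switching times in [s] form a null set. *)
Lemma caratheodory_solution_piecewise (R : realType) (n : nat)
    (a : R -> 'M[R]_n) (x : R -> 'cV[R]_n) (s : seq R) :
  lipschitz_on_segments x ->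
  (forall t : R, 0 < t -> t \notin s -> is_derive t 1 x (a t *m x t)) ->
  caratheodory_solution a (x 0) x.
Proof.
move=> lx dx; split=> // [T _|]; first exact: lipschitz_absolutely_continuous.
have cs : countable [set` s] by exact: finite_set_countable.
exists [set` s]; split.
- exact: countable_measurable.
- exact: countable_lebesgue_measure0.
- by move=> t /= ndx; apply: contrapT => /negP ts; apply: ndx => t0; exact: dx.
Qed.

Section Concatenation.
Variables (R : realType) (n : nat) (B : 'M[R]_n) (x : R -> 'cV[R]_n) (T : R).
Hypothesis T0 : 0 <= T.

Definition prolong (t : R) : 'cV[R]_n :=
  if t <= T then x t else expmx B (t - T) *m x T.

Lemma prolong_le t : t <= T -> prolong t = x t.
Proof. by rewrite /prolong => ->. Qed.

Lemma prolong_ge t : T <= t -> prolong t = expmx B (t - T) *m x T.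
Proof.
rewrite /prolong le_eqVlt => /orP[/eqP <-|Tt].
  by rewrite lexx subrr expmx0 mul1mx.
by rewrite leNgt Tt.
Qed.

Lemma prolong_lipschitz :
  lipschitz_on_segments x -> lipschitz_on_segments prolong.
Proof.
move=> lx S; have [C C0 lC] := lx T.
have [|D D0 lD] := @linear_flow_lipschitz R n B (fun t => expmx B t *m x T) _ S.
  by move=> t; rewrite mulmxA; exact/is_derive_mulmx_cst/is_derive_expmx.
have lge (u v : R) : T <= u -> u <= v -> v <= S ->
    `|prolong v - prolong u| <= D * (v - u).
  move=> Tu uv vS; rewrite !prolong_ge//; last exact: le_trans uv.
  rewrite (_ : v - u = v - T - (u - T)); last by ring.
  by apply: lD; have := T0; lra.
have lle (u v : R) : 0 <= u -> u <= v -> v <= T ->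
    `|prolong v - prolong u| <= C * (v - u).
  move=> u0 uv vT; rewrite !prolong_le//; last exact: le_trans vT.
  exact: lC.
exists (C + D); first by rewrite addr_ge0.
move=> u v u0 uv vS.
have Dv : 0 <= D * (v - u) by rewrite mulr_ge0// subr_ge0.
have Cv : 0 <= C * (v - u) by rewrite mulr_ge0// subr_ge0.
have [vT|Tv] := leP v T.
  by rewrite (le_trans (lle _ _ _ _ _))//; lra.
have [Tu|uT] := leP T u.
  by rewrite (le_trans (lge _ _ _ _ _))//; lra.
(* An interval straddling [T] is split at [T], where both estimates apply. *)
rewrite -[_ - _](subrKA (prolong T)) (le_trans (ler_normD _ _))//.
have h1 := lge T v (lexx _) (ltW Tv) vS.
have h2 := lle u T u0 (ltW uT) (lexx _).
have : D * (v - T) <= D * (v - u) by rewrite ler_wpM2l//; lra.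
have : C * (T - u) <= C * (v - u) by rewrite ler_wpM2l//; lra.
by lra.
Qed.

Lemma is_derive_prolong_lt (t : R) dx : t < T ->
  is_derive t 1 x dx -> is_derive t 1 prolong dx.
Proof.
move=> tT; apply: near_eq_is_derive.
near=> s; rewrite prolong_le// ltW//.
by near: s; exact: lt_nbhsl.
Unshelve. all: by end_near. Qed.

Lemma is_derive_prolong_gt (t : R) : T < t ->
  is_derive t 1 prolong (B *m prolong t).
Proof.
move=> Tt; rewrite prolong_ge ?ltW// mulmxA.
have : is_derive t 1 (fun s => expmx B (s - T) *m x T)
    (B *m expmx B (t - T) *m x T).
  by apply/is_derive_mulmx_cst/is_derive_translate/is_derive_expmx.
apply: near_eq_is_derive.
near=> s; rewrite prolong_ge// ltW//.
by near: s; exact: lt_nbhsr.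
Unshelve. all: by end_near. Qed.

End Concatenation.

(** Transition matrices over duration [T] under piecewise constant switching; the latest factor
    stands on the left. *)
Inductive flow_product (R : realType) (n : nat) (A : set 'M[R]_n) :
    R -> 'M[R]_n -> Prop :=
| flow_product1 : flow_product A 0 1%:M
| flow_productM (T h : R) (P B : 'M[R]_n) : flow_product A T P -> 0 < h -> A B ->
    flow_product A (T + h) (expmx B h *m P).

Section FlowProduct.
Variables (R : realType) (n : nat) (A : set 'M[R]_n).

Lemma flow_product_ge0 T P : flow_product A T P -> 0 <= T.
Proof. by elim=> // {}T h {}P B _ T0 h0 _; rewrite addr_ge0// ltW. Qed.

(** A factor on the right is a period of [B] preceding the others, as needed to evaluate the
    Lyapunov function after flowing along [B]. *)
Lemma flow_product_Mr T P h B : flow_product A T P -> 0 < h -> A B ->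
  flow_product A (T + h) (P *m expmx B h).
Proof.
move=> fP h0 AB; elim: fP => [|{}T k {}P C _ ih k0 AC].
  by rewrite mul1mx -[expmx B h]mulmx1; apply: flow_productM => //; constructor.
by rewrite -mulmxA addrAC; exact: flow_productM.
Qed.

(** Nonemptiness of [A] supplies the constant signal that starts the induction. One signal serves
    all initial values. *)
Lemma flow_product_solution T P : A !=set0 -> flow_product A T P ->
  exists2 a, switching_function A a &
    forall x0, exists2 x, caratheodory_solution a x0 x & x T = P *m x0.
Proof.
move=> [B0 AB0] fP.
suff [a [s [sa h]]] : exists (a : R -> 'M[R]_n) (s : seq R), switching_function A a /\
    forall x0, exists x : R -> 'cV[R]_n, [/\ lipschitz_on_segments x,
      forall t : R, 0 < t -> t \notin s -> is_derive t 1 x (a t *m x t),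
      x 0 = x0 & x T = P *m x0].
  exists a => // x0; have [x [lx dx <- xT]] := h x0.
  by exists x => //; exact: caratheodory_solution_piecewise dx.
elim: fP => [|{}T h {}P B fP [a [s [sa ih]]] h0 AB].
  exists (fun=> B0), [::]; split; first exact: switching_function_cst.
  move=> x0.
  have d (t : R) : is_derive t 1 (fun t => expmx B0 t *m x0)
      (B0 *m (expmx B0 t *m x0)).
    by rewrite mulmxA; exact/is_derive_mulmx_cst/is_derive_expmx.
  exists (fun t => expmx B0 t *m x0); split => //.
  - exact: linear_flow_lipschitz d.
  - by rewrite expmx0 mul1mx.
  - by rewrite expmx0.
have T0 := flow_product_ge0 fP.
(* From time [T] on the signal is [B], and [T] joins the times where differentiability may fail. *)
exists (fun t => if t < T then a t else B), (T :: s).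
split; first exact: switching_function_if.
move=> x0; have [x [lx dx x00 xT]] := ih x0.
exists (prolong B x T); split.
- exact: prolong_lipschitz.
- move=> t t0; rewrite inE negb_or => /andP[tT ts].
  have [ltT|Tt|eT] := ltgtP t T; last by rewrite eT eqxx in tT.
  + by rewrite prolong_le ?ltW//; apply: is_derive_prolong_lt => //; exact: dx.
  + exact: is_derive_prolong_gt.
- by rewrite prolong_le.
- rewrite prolong_ge; last by rewrite lerDl ltW.
  by rewrite addrAC subrr add0r xT mulmxA.
Qed.

End FlowProduct.

(** * The cone of dissipative matrices *)

Lemma is_derive_expansion (R : realType) (W : normedModType R) (x : R -> W)
    (t : R) (w : W) : is_derive t 1 x w ->
  forall e : R, 0 < e -> exists2 r : R, 0 < r &
    forall h : R, `|h| < r -> `|x (t + h) - (x t + h *: w)| <= e * `|h|.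
Proof.
move=> [dx dxw] e e0.
have : h^-1 *: (x (h *: (1 : R) + t) - x t) @[h --> (0 : R)^'] --> w.
  by rewrite -dxw; exact: dx.
move=> /cvgrPdist_le /(_ _ e0) [r /= r0 xr].
exists r => // h hr.
have [->|h0] := eqVneq h 0; first by rewrite addr0 scale0r addr0 subrr !normr0 mulr0.
have := xr h; rewrite /= sub0r normrN => /(_ hr h0).
rewrite -[h *: 1]/(h * 1) mulr1 -(ler_pM2r (_ : 0 < `|h|)) ?normr_gt0// => {xr}.
congr (_ <= _).
rewrite mulrC -normrZ scalerBr scalerA divff// scale1r (addrC h t).
by rewrite distrC opprD addrA.
Qed.

(** Product rule: an exponential weight shifts the matrix by [k%:M], so decay at rate [k] becomes
    monotonicity of [V] along the weighted trajectory. *)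
Lemma is_derive_expR_scale (R : realType) (n : nat) (B : 'M[R]_n)
    (x : R -> 'cV[R]_n) (k t : R) :
  is_derive t 1 x (B *m x t) ->
  is_derive t 1 (fun s => expR (k * s) *: x s)
    ((B + k%:M) *m (expR (k * t) *: x t)).
Proof.
move=> /is_derive_mxP dx; apply/is_derive_mxP => i j.
have dk : is_derive t 1 (fun s : R => expR (k * s)) (k * expR (k * t)).
  have dkid : is_derive t 1 (fun s : R => k * s) k.
    have := @is_deriveZ _ _ _ id k t 1 1 (is_derive_id t (1 : R)).
    by rewrite [k *: 1]mulr1.
  have := @is_derive1_comp R expR (fun s => k * s) t _ _ (is_derive_expR _) dkid.
  by rewrite mulrC.
have := @is_deriveM _ _ _ _ t 1 _ _ dk (dx i j).
have -> : (fun s => (expR (k * s) *: x s) i j) =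
    (fun s : R => expR (k * s)) * (fun s => x s i j).
  by apply/funext => s; rewrite mxE.
have -> : ((B + k%:M) *m (expR (k * t) *: x t)) i j =
    expR (k * t) *: (B *m x t) i j + x t i j *: (k * expR (k * t)).
  by rewrite mulmxDl mul_scalar_mx -scalemxAr !mxE /GRing.scale/=; ring.
by [].
Qed.

(** The extra term [v - u] accommodates factors that are Lipschitz in time, such as an exponential
    weight. *)
Lemma absolutely_continuous_dominated (R : realType) (W W' : normedModType R)
    (T C : R) (x : R -> W) (g : R -> W') :
  0 <= C -> absolutely_continuous 0 T x ->
  (forall u v : R, 0 <= u -> u <= v -> v <= T ->
    `|g v - g u| <= C * (`|x v - x u| + (v - u))) ->
  absolutely_continuous 0 T g.
Proof.
move=> C0 acx gx e e0.
have C1 : 0 < C + 1 by lra.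
pose e' := e / (C + 1) / 2.
have e'0 : 0 < e' by rewrite !divr_gt0.
have [d d0 xd] := acx _ e'0.
exists (Num.min d e'); first by rewrite lt_min d0.
move=> k u v uv tuv; rewrite lt_min => /andP[sd se].
have h := xd k u v uv tuv sd.
apply: (@le_lt_trans _ _
    (\sum_(i < k) C * (`|x (v i) - x (u i)| + (v i - u i)))).
  by apply: ler_sum => i _; have [? [? ?]] := uv i; exact: gx.
rewrite -mulr_sumr big_split/=.
have s0 : 0 <= \sum_(i < k) (v i - u i).
  by apply: sumr_ge0 => i _; have [? [? ?]] := uv i; rewrite subr_ge0.
have s1 : 0 <= \sum_(i < k) `|x (v i) - x (u i)| by exact: sumr_ge0.
have -> : e = (C + 1) * (e' + e').
  by rewrite /e' -splitr mulrC divfK// gt_eqF.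
by nra.
Qed.

Section Dissipative.
Variables (R : realType) (n : nat) (V : 'cV[R]_n -> R) (L : R).
Hypothesis L0 : 0 <= L.
Hypothesis VL : forall x, V x <= L * `|x|.
Hypothesis VD : forall x y : 'cV[R]_n, V (x + y) <= V x + V y.
Hypothesis VZ : forall (c : R) (x : 'cV[R]_n), 0 < c -> V (c *: x) = c * V x.
Hypothesis V_ge0 : forall x, 0 <= V x.

(* The one-sided directional derivative of [V] at any [x] along [B *m x] is
   nonpositive. *)
Definition dissipative (B : 'M[R]_n) : Prop :=
  forall x (e : R), 0 < e -> exists2 r : R, 0 < r &
    forall h : R, 0 < h -> h < r -> V (x + h *: (B *m x)) <= V x + e * h.

(** Subadditivity turns the bound by the norm into a Lipschitz estimate. *)
Lemma sublinear_dist x y : V x <= V y + L * `|x - y|.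
Proof.
have := VD y (x - y); rewrite addrC subrK => /le_trans; apply.
by rewrite lerD2l.
Qed.

Lemma sublinear_midpoint x y : V (2^-1 *: x + 2^-1 *: y) <= (V x + V y) / 2.
Proof.
have h0 : 0 < (2^-1 : R) by rewrite invr_gt0.
by rewrite (le_trans (VD _ _))// !VZ//; lra.
Qed.

(** A step [h] along [B + C] is the midpoint of steps [2 h] along [B] and along [C], which is why
    the radius is halved. *)
Lemma dissipativeD B C : dissipative B -> dissipative C -> dissipative (B + C).
Proof.
move=> dB dC x e e0.
have e2 : 0 < e / 2 by lra.
have [r r0 rB] := dB x _ e2; have [s s0 sC] := dC x _ e2.
exists (Num.min r s / 2); first by rewrite divr_gt0// lt_min r0.
move=> h h0; rewrite ltr_pdivlMr// lt_min => /andP[hr hs].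
have h2 : 0 < h * 2 by lra.
have := rB _ h2 hr; have := sC _ h2 hs.
have -> : x + h *: ((B + C) *m x) =
    2^-1 *: (x + (h * 2) *: (B *m x)) + 2^-1 *: (x + (h * 2) *: (C *m x)).
  rewrite !scalerDr !scalerA mulmxDl scalerDr addrACA -scalerDl.
  rewrite -div1r -splitr scale1r.
  by rewrite (_ : 1 / 2 * (h * 2) = h)//; field.
have := sublinear_midpoint (x + (h * 2) *: (B *m x)) (x + (h * 2) *: (C *m x)).
by lra.
Qed.

Lemma dissipativeZ c B : 0 < c -> dissipative B -> dissipative (c *: B).
Proof.
move=> c0 dB x e e0.
have ec : 0 < e / c by rewrite divr_gt0.
have [r r0 rB] := dB x _ ec.
exists (r / c); first by rewrite divr_gt0.
move=> h h0; rewrite ltr_pdivlMr// => hr.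
have hc : 0 < h * c by rewrite mulr_gt0.
have := rB _ hc hr.
rewrite -scalemxAl scalerA (_ : e / c * (h * c) = e * h)//.
by field; rewrite gt_eqF.
Qed.

Lemma dissipative_scalarN (c : R) : 0 <= c -> dissipative (- c%:M).
Proof.
move=> c0 x e e0; have c1 : 0 < c + 1 by lra.
(* For such [h] the factor [1 - h * c] is positive, so homogeneity applies. *)
exists (c + 1)^-1; first by rewrite invr_gt0.
move=> h h0; rewrite -[X in _ < X]div1r ltr_pdivlMr// => hc.
rewrite mulNmx mul_scalar_mx scalerN scalerA -{1}[x]scale1r -scalerBl.
rewrite VZ; last by lra.
have : 0 <= h * c * V x by rewrite !mulr_ge0// ltW.
have : 0 <= e * h by rewrite mulr_ge0// ltW.
by lra.
Qed.

Lemma dissipative_lower (k l : R) B :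
  k <= l -> dissipative (B + l%:M) -> dissipative (B + k%:M).
Proof.
move=> kl dB.
have -> : B + k%:M = (B + l%:M) + - (l - k)%:M.
  by rewrite raddfB/= opprB addrA (addrAC B) addrK.
by apply: dissipativeD => //; apply: dissipative_scalarN; rewrite subr_ge0.
Qed.

(** The matrices [B] with [B + l%:M] dissipative form a translate of a convex cone, hence a convex
    set; it contains [A]. *)
Lemma dissipative_convex (l : R) (A : set 'M[R]_n) :
  (forall B, A B -> dissipative (B + l%:M)) ->
  forall B, convex_hull A B -> dissipative (B + l%:M).
Proof.
move=> dA B.
apply: (@smallest_sub _ (@convex_set R 'M[R]_n) A
  [set B | dissipative (B + l%:M)]) => //.
(* Only weights strictly between 0 and 1 remain, so both scaling factors are positive. *)
apply/convex_setW => C D; rewrite !inE/= => dC dD p p0 p1; rewrite inE/=.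
set p' : R := p%:num in p0 p1.
rewrite (_ : _ + _ = p' *: (C + l%:M) + (1 - p') *: (D + l%:M)).
  by apply: dissipativeD; apply: dissipativeZ => //; rewrite subr_gt0.
rewrite !scalerDr addrACA -scalerDl subrKC scale1r.
by [].
Qed.

(** To the right of [t], dissipativity bounds [V] on the tangent line and the Lipschitz estimate
    passes to [x]. To the left, convexity is used: a backward increment of [V] along a line is at
    most the forward one. *)
Lemma dissipative_slope B (x : R -> 'cV[R]_n) (t e : R) :
  dissipative B -> is_derive t 1 x (B *m x t) -> 0 < e ->
  exists2 r, 0 < r & forall s s', t - r < s -> s <= t -> t <= s' ->
    s' < t + r -> V (x s') - V (x s) <= e * (s' - s).
Proof.
move=> dB dx e0.
have L1 : 0 < L + 1 by rewrite ltr_wpDl.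
(* The expansion error, multiplied by [L], costs half of [e]; [L + 1] is positive even if [L] is
   0. *)
pose e1 := e / 2 / (L + 1).
have e10 : 0 < e1 by rewrite !divr_gt0.
have Le1 : L * e1 <= e / 2.
  rewrite (_ : e / 2 = (L + 1) * e1); first by rewrite ler_pM2r// lerDl.
  by rewrite /e1 [RHS]mulrC divfK// gt_eqF.
have e2 : 0 < e / 2 by lra.
have [r r0 rB] := dB (x t) _ e2.
have [q q0 xq] := is_derive_expansion dx e10.
have err (h : R) : `|h| < q ->
    L * `|x (t + h) - (x t + h *: (B *m x t))| <= e / 2 * `|h|.
  move=> hq; have := xq h hq.
  have := ler_wpM2l L0 (xq h hq); rewrite mulrA => /le_trans + _; apply.
  by rewrite ler_wpM2r.
exists (Num.min r q); first by rewrite lt_min r0.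
move=> s s' ts st ts' s't.
suff [right left] : V (x s') - V (x t) <= e * (s' - t) /\
    V (x t) - V (x s) <= e * (t - s) by lra.
split.
- have [<-|ne] := eqVneq t s'; first by lra.
  pose h := s' - t.
  have h0 : 0 < h by rewrite /h subr_gt0 lt_neqAle ne.
  have : h < Num.min r q by rewrite /h; lra.
  rewrite lt_min => /andP[hr hq].
  have Es : s' = t + h by rewrite /h addrC subrK.
  have := err h; rewrite gtr0_norm// => /(_ hq).
  have := rB h h0 hr.
  have := sublinear_dist (x (t + h)) (x t + h *: (B *m x t)).
  by rewrite Es; lra.
- have [->|ne] := eqVneq s t; first by lra.
  pose h := t - s.
  have h0 : 0 < h by rewrite /h subr_gt0 lt_neqAle ne.
  have : h < Num.min r q by rewrite /h; lra.
  rewrite lt_min => /andP[hr hq].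
  have Es : s = t - h by rewrite /h opprB addrC subrK.
  have := err (- h); rewrite normrN gtr0_norm// => /(_ hq).
  have := rB h h0 hr.
  have := sublinear_dist (x t - h *: (B *m x t)) (x (t - h)).
  (* [x t] is the midpoint of its forward and backward steps, so [V (x t)] exceeds the backward
     value by at most [e / 2 * h]. *)
  have := sublinear_midpoint (x t + h *: (B *m x t)) (x t - h *: (B *m x t)).
  rewrite -scalerDr addrACA subrr addr0 scalerDr -scalerDl -div1r -splitr.
  rewrite scale1r scaleNr distrC Es.
  by lra.
Qed.

Lemma dissipative_nonincreasing (x : R -> 'cV[R]_n) (T : R) :
  0 <= T -> absolutely_continuous 0 T x ->
  {ae @lebesgue_measure R, forall t : R, 0 < t ->
    exists2 B, dissipative B & is_derive t 1 x (B *m x t)} ->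
  V (x T) <= V (x 0).
Proof.
move=> T0 acx dx.
(* Time 0 joins the exceptional set because the equation is given only for positive times. *)
apply: (@absolutely_continuous_nonincreasing R (fun t => V (x t)) T
  (~` [set t : R | 0 < t -> exists2 B, dissipative B & is_derive t 1 x (B *m x t)]
    `|` [set 0])) => //.
- apply: (absolutely_continuous_dominated L0 acx) => u v u0 uv vT /=.
  have := sublinear_dist (x v) (x u); have := sublinear_dist (x u) (x v).
  have := mulr_ge0 L0 (_ : 0 <= v - u); rewrite subr_ge0 => /(_ uv).
  rewrite (distrC (x u)) ler_norml; lra.
- apply: negligibleU; first exact: dx.
  exists [set 0]; split => //; exact: lebesgue_measure_set1.
- move=> t e /andP[t0 tT] /not_orP[/contrapT/= ht tn0] e0.
  have [|B dB dxB] := ht.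
    by rewrite lt_neqAle t0 andbT; apply/eqP => /esym.
  exact: dissipative_slope dB dxB e0.
Qed.

Lemma dissipative_exponential_decay (A : set 'M[R]_n) (k : R) (x0 : 'cV[R]_n)
    (a : R -> 'M[R]_n) (x : R -> 'cV[R]_n) (T : R) :
  (forall y, `|y| <= V y) -> 0 <= k ->
  (forall B, A B -> dissipative (B + k%:M)) ->
  switching_function A a -> caratheodory_solution a x0 x -> 0 <= T ->
  expR (k * T) * V (x T) <= V x0.
Proof.
move=> normV k0 dA [Aa _] [x00 acx dx] T0.
(* A first pass at rate 0 bounds [x]; the bound is needed for absolute continuity of the weighted
   trajectory [y]. *)
have nonincr t : 0 <= t -> V (x t) <= V (x 0).
  move=> t0; apply: dissipative_nonincreasing => //; first exact: acx.
  apply: negligibleS dx; apply: subsetC => s ds s0; exists (a s); last exact: ds.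
  rewrite -[a s]addr0 -(raddf0 (@scalar_mx R n)).
  by apply: (dissipative_lower k0); apply: dA; apply: Aa; exact: ltW.
pose y t := expR (k * t) *: x t.
have y0 : y 0 = x0 by rewrite /y mulr0 expR0 scale1r.
rewrite -VZ ?expR_gt0// -/(y T) -y0.
apply: dissipative_nonincreasing => //; last first.
  apply: negligibleS dx; apply: subsetC => s ds s0; exists (a s + k%:M).
    by apply: dA; apply: Aa; exact: ltW.
  by apply: is_derive_expR_scale; exact: ds.
pose K := V (x 0).
have K0 : 0 <= K by exact: V_ge0.
pose E := expR (k * T).
have E0 : 0 <= E by exact: expR_ge0.
have EkK : 0 <= E * k * K by rewrite !mulr_ge0.
have CE : 0 <= E + E * k * K by rewrite addr_ge0.
apply: (absolutely_continuous_dominated CE (acx T T0)).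
move=> u v u0 uv vT.
have -> : y v - y u = expR (k * v) *: (x v - x u) +
    (expR (k * v) - expR (k * u)) *: x u.
  by rewrite scalerBr scalerBl addrA subrK.
have Ev : expR (k * v) <= E by rewrite ler_expR ler_wpM2l.
(* From [1 + z <= expR z] at [z = k * (u - v)], multiplied by [expR (k * v)]. *)
have dE : expR (k * v) - expR (k * u) <= E * k * (v - u).
  have := expR_ge1Dx (k * (u - v)).
  have -> : expR (k * u) = expR (k * (u - v)) * expR (k * v).
    by rewrite -expRD -mulrDr subrK.
  have := expR_gt0 (k * v).
  have : 0 <= k * (v - u) by rewrite mulr_ge0// subr_ge0.
  by nra.
have dE0 : 0 <= expR (k * v) - expR (k * u).
  by rewrite subr_ge0 ler_expR ler_wpM2l.
rewrite (le_trans (ler_normD _ _))// !normrZ (ger0_norm dE0).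
rewrite (ger0_norm (expR_ge0 _)).
have xu : `|x u| <= K by rewrite (le_trans (normV _))// nonincr.
have h1 : expR (k * v) * `|x v - x u| <= E * `|x v - x u| by rewrite ler_wpM2r.
have h2 : (expR (k * v) - expR (k * u)) * `|x u| <= E * k * (v - u) * K.
  by rewrite ler_pM.
have h3 : 0 <= E * k * K * `|x v - x u| by rewrite mulr_ge0.
have h4 : 0 <= E * (v - u) by rewrite mulr_ge0// subr_ge0.
have -> : (E + E * k * K) * (`|x v - x u| + (v - u)) = E * `|x v - x u| +
   E * k * (v - u) * K + E * k * K * `|x v - x u| + E * (v - u) by ring.
by lra.
Qed.

End Dissipative.

(** * The Lyapunov function *)

Lemma norm_le_enorm (R : realType) (n : nat) (x : 'cV[R]_n) : `|x| <= enorm x.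
Proof.
apply: mx_norm_le => [|i j]; first exact: sqrtr_ge0.
rewrite ord1 -sqrtr_sqr ler_wsqrtr// (bigD1 i)//= lerDl.
by apply: sumr_ge0 => k _; exact: sqr_ge0.
Qed.

Lemma enorm_le_norm (R : realType) (n : nat) (x : 'cV[R]_n) :
  enorm x <= n%:R * `|x|.
Proof.
rewrite -[leRHS]ger0_norm ?mulr_ge0// -sqrtr_sqr ler_wsqrtr// exprMn.
apply: (@le_trans _ _ (n%:R * `|x| ^+ 2)).
  rewrite -[n in n%:R]card_ord mulr_natl -sumr_const ler_sum// => i _.
  by rewrite -real_normK ?num_real// lerXn2r ?nnegrE// mx_entry_norm.
rewrite ler_wpM2r ?sqr_ge0// -natrX ler_nat.
by case: n {x} => // n; rewrite expnS leq_pmulr// expn1.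
Qed.

(** All that is retained of the stability of [A], stated in the max norm; uniform stability gives
    [lam = 0]. *)
Definition growth_bound (R : realType) (n : nat) (A : set 'M[R]_n)
    (M lam : R) : Prop :=
  forall T P (x : 'cV[R]_n), flow_product A T P ->
    expR (lam * T) * `|P *m x| <= M * `|x|.

Section Lyapunov.
Variables (R : realType) (n : nat) (A : set 'M[R]_n) (M lam : R).
Hypothesis AM : growth_bound A M lam.

Definition lyapunov (x : 'cV[R]_n) : R :=
  sup [set y | exists T P, flow_product A T P /\
                           y = expR (lam * T) * `|P *m x|].

Lemma lyapunov_ub T P x : flow_product A T P ->
  expR (lam * T) * `|P *m x| <= lyapunov x.
Proof.
move=> fP; apply: ub_le_sup; last by exists T, P.
by exists (M * `|x|) => _ [S [Q [fQ ->]]]; exact: AM.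
Qed.

Lemma lyapunov_le x (c : R) :
  (forall T P, flow_product A T P -> expR (lam * T) * `|P *m x| <= c) ->
  lyapunov x <= c.
Proof.
move=> xc; apply: ge_sup; last by move=> _ [T [P [fP ->]]]; exact: xc.
by eexists; exists 0, 1%:M; split; [exact: flow_product1|reflexivity].
Qed.

Lemma norm_le_lyapunov x : `|x| <= lyapunov x.
Proof.
have := @lyapunov_ub 0 1%:M x (flow_product1 A).
by rewrite mulr0 expR0 mul1r mul1mx.
Qed.

Lemma lyapunov_ge0 x : 0 <= lyapunov x.
Proof. by rewrite (le_trans _ (norm_le_lyapunov x)). Qed.

Lemma lyapunov_le_norm x : lyapunov x <= M * `|x|.
Proof. by apply: lyapunov_le => T P; exact: AM. Qed.

Lemma lyapunovD x y : lyapunov (x + y) <= lyapunov x + lyapunov y.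
Proof.
apply: lyapunov_le => T P fP; rewrite mulmxDr.
apply: (le_trans (ler_wpM2l (expR_ge0 _) (ler_normD _ _))).
by rewrite mulrDr lerD// lyapunov_ub.
Qed.

Lemma lyapunovZ (c : R) x : 0 < c -> lyapunov (c *: x) = c * lyapunov x.
Proof.
have scale_le (b : R) y : 0 < b -> lyapunov (b *: y) <= b * lyapunov y.
  move=> b0; apply: lyapunov_le => T P fP.
  rewrite -scalemxAr normrZ gtr0_norm// mulrCA ler_pM2l//.
  exact: lyapunov_ub.
move=> c0; apply/eqP; rewrite eq_le scale_le//=.
rewrite -ler_pdivlMl//.
have := @scale_le c^-1 (c *: x); rewrite scalerA mulVf ?gt_eqF// scale1r.
by apply; rewrite invr_gt0.
Qed.

(** Each [P *m expmx B h] is again a flow product, of duration [T + h], so the left supremum runs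
    over some of the values on the right. *)
Lemma lyapunov_flow (B : 'M[R]_n) (h : R) x : A B -> 0 < h ->
  lyapunov (expR (lam * h) *: (expmx B h *m x)) <= lyapunov x.
Proof.
move=> AB h0; rewrite lyapunovZ ?expR_gt0// -ler_pdivlMl ?expR_gt0//.
apply: lyapunov_le => T P fP.
rewrite ler_pdivlMl ?expR_gt0// mulrA -expRD -mulrDr addrC mulmxA.
exact/lyapunov_ub/flow_product_Mr.
Qed.

(** The weighted flow line of [B] through [x] has tangent [(B + lam%:M) *m x] at time 0, and
    [lyapunov] does not exceed its initial value along it; the Lipschitz estimate carries this over
    to the tangent up to [e * h]. *)
Lemma dissipative_generator (B : 'M[R]_n) : 0 <= M -> A B ->
  dissipative lyapunov (B + lam%:M).
Proof.
move=> M0 AB x e e0.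
have M1 : 0 < M + 1 by rewrite ltr_wpDl.
have d1 : 0 < e / (M + 1) by rewrite divr_gt0.
have : is_derive (0 : R) 1 (fun s => expR (lam * s) *: (expmx B s *m x))
    ((B + lam%:M) *m x).
  have := @is_derive_expR_scale R n B (fun s => expmx B s *m x) lam 0.
  rewrite mulr0 expR0 scale1r expmx0 mul1mx; apply.
  have := is_derive_mulmx_cst x (is_derive_expmx B 0).
  by rewrite expmx0 mulmx1.
move=> /is_derive_expansion /(_ _ d1) [r r0 xr].
exists r => // h h0 hr.
have := xr h; rewrite gtr0_norm// => /(_ hr).
rewrite add0r mulr0 expR0 scale1r expmx0 mul1mx.
set y := expR _ *: _; set z := x + _ => yz.
have := sublinear_dist lyapunov_le_norm lyapunovD z y.
have := lyapunov_flow x AB h0; rewrite -/y distrC.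
have : M * `|y - z| <= e * h.
  apply: (@le_trans _ _ ((M + 1) * (e / (M + 1) * h))).
    by rewrite ler_pM// lerDl.
  by rewrite mulrA (mulrC (M + 1)) divfK// gt_eqF.
by rewrite distrC; lra.
Qed.

End Lyapunov.

(** * From stability to growth bounds *)

(** Isolates duration 0, where [A] may be empty and the estimate of [GUES] does not speak. *)
Lemma flow_product_dichotomy (R : realType) (n : nat) (A : set 'M[R]_n)
    (T : R) (P : 'M[R]_n) : flow_product A T P ->
  (T = 0 /\ P = 1%:M) \/ (0 < T /\ A !=set0).
Proof.
case=> [|{}T h {}P B fP h0 AB]; first by left.
by right; split; [rewrite ltr_wpDl// (flow_product_ge0 fP)|exists B].
Qed.

Lemma uniformly_stable_growth_bound (R : realType) (n : nat)
    (A : set 'M[R]_n) : uniformly_stable A ->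
  exists2 M : R, 0 <= M & growth_bound A M 0.
Proof.
move=> /(_ 1 ltr01) [d d0 stable].
(* [n.+1] keeps [c] positive in dimension 0; the bound [c + 1] below also covers the identity
   product. *)
pose c := n.+1%:R / d.
have c0 : 0 < c by rewrite divr_gt0.
exists (c + 1); first by rewrite addr_ge0// ltW.
move=> T P x fP; rewrite mul0r expR0 mul1r.
have [[_ ->]|[T0 A0]] := flow_product_dichotomy fP.
  by rewrite mul1mx ler_peMl// lerDr ltW.
have [a sa sol] := flow_product_solution A0 fP.
have [->|x0] := eqVneq x 0; first by rewrite mulmx0 normr0 mulr0.
have nx : 0 < `|x| by rewrite normr_gt0.
(* By linearity [x] may be rescaled; this factor brings its Euclidean norm below [d]. *)
pose k := (c * `|x|)^-1.
have k0 : 0 < k by rewrite invr_gt0 mulr_gt0.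
have [y soly yT] := sol (k *: x).
have : enorm (y T) <= 1.
  apply: (stable T (k *: x) a y _ _ sa soly); first exact: ltW.
  rewrite (le_trans (enorm_le_norm _))// normrZ gtr0_norm//.
  have -> : n%:R * (k * `|x|) = d * (n%:R / n.+1%:R).
    by rewrite /k /c; field; rewrite !gt_eqF//= addrC natr1.
  by rewrite ler_piMr ?(ltW d0)// ler_pdivrMr// mul1r ler_nat.
rewrite yT -scalemxAr => /(le_trans (norm_le_enorm _)).
rewrite normrZ gtr0_norm// /k -ler_pdivlMl ?invr_gt0 ?(mulr_gt0 c0 nx)//.
rewrite invrK mulr1 => /le_trans; apply.
by rewrite ler_wpM2r// lerDl.
Qed.

Lemma GUES_growth_bound (R : realType) (n : nat) (A : set 'M[R]_n) :
  GUES A -> exists M lam : R, [/\ 0 <= M, 0 < lam & growth_bound A M lam].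
Proof.
move=> [M [lam [M0 lam0 stable]]].
exists (M * n%:R + 1), lam; split => //; first by rewrite addr_ge0// mulr_ge0// ltW.
move=> T P x fP.
have [[-> ->]|[T0 A0]] := flow_product_dichotomy fP.
  by rewrite mul1mx mulr0 expR0 mul1r ler_peMl// lerDr mulr_ge0// ltW.
have [a sa sol] := flow_product_solution A0 fP.
have [y soly yT] := sol x.
have := stable x T a y T0 sa soly; rewrite yT => /(le_trans (norm_le_enorm _)).
rewrite mulNr expRN mulrAC ler_pdivlMr ?expR_gt0// mulrC => /le_trans; apply.
rewrite mulrDl mul1r -mulrA (@le_trans _ _ (M * (n%:R * `|x|)))//.
  by rewrite ler_pM2l// enorm_le_norm.
by rewrite lerDl.
Qed.

(** * Transfer between sets with the same semicone *)

Section SameSemicone.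
Variables (R : realType) (n : nat) (A A' : set 'M[R]_n).
Hypothesis AA' : convex_semicone A = convex_semicone A'.

Lemma sub_convex_semicone B : A' B ->
  exists l C, [/\ 0 < l, convex_hull A C & B = l *: C].
Proof.
move=> A'B.
have : convex_semicone A' B.
  by exists 1 => //; exists B; [exact: sub_gen_smallest|rewrite scale1r].
by rewrite -AA' => -[l l0 [C AC ->]]; exists l, C.
Qed.

Section Bounds.
Variables (M lam : R).
Hypotheses (M0 : 0 <= M) (AM : growth_bound A M lam).
Let V := lyapunov A lam.

Lemma dissipative_semicone (l : R) C : 0 < l -> convex_hull A C ->
  dissipative V (l *: C + (l * lam)%:M).
Proof.
move=> l0 AC; rewrite -scale_scalar_mx -scalerDr.
apply: dissipativeZ => //.
apply: (dissipative_convex (lyapunovD AM) (lyapunovZ AM)) AC => B AB.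
exact: (dissipative_generator AM M0 AB).
Qed.

(** The factor [n%:R * M] collects the comparisons of [enorm], the max norm and [V] at both ends of
    the trajectory. *)
Lemma solution_decay (k : R) (a : R -> 'M[R]_n) (x0 : 'cV[R]_n)
    (x : R -> 'cV[R]_n) (T : R) : 0 <= k ->
  (forall B, A' B -> dissipative V (B + k%:M)) ->
  switching_function A' a -> caratheodory_solution a x0 x -> 0 <= T ->
  enorm (x T) <= n%:R * M * expR (- k * T) * enorm x0.
Proof.
move=> k0 dA' sa solx T0.
have := dissipative_exponential_decay M0 (lyapunov_le_norm AM) (lyapunovD AM)
  (lyapunovZ AM) (lyapunov_ge0 AM) (norm_le_lyapunov AM) k0 dA' sa solx T0.
move=> /le_trans /(_ (lyapunov_le_norm AM _)) decay.
rewrite (le_trans (enorm_le_norm _))// -!mulrA ler_wpM2l//.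
rewrite (le_trans (norm_le_lyapunov AM _))// mulNr expRN mulrCA.
rewrite ler_pdivlMl ?expR_gt0// (le_trans decay)//.
by rewrite ler_wpM2l// norm_le_enorm.
Qed.

End Bounds.

Lemma uniformly_stable_semicone : uniformly_stable A -> uniformly_stable A'.
Proof.
move=> /uniformly_stable_growth_bound [M M0 AM] e e0.
pose c := n%:R * M + 1.
have c0 : 0 < c by rewrite ltr_wpDl// mulr_ge0.
exists (e / c); first by rewrite divr_gt0.
move=> t x0 a x t0 x0d sa solx.
(* At rate 0 the shift [l * 0] vanishes whatever the scaling [l]. *)
have dA' B : A' B -> dissipative (lyapunov A 0) (B + (0 : R)%:M).
  move=> /sub_convex_semicone [l [C [l0 AC ->]]].
  by have := dissipative_semicone M0 AM l0 AC; rewrite mulr0.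
rewrite (le_trans (solution_decay M0 AM (lexx 0) dA' sa solx t0))//.
rewrite oppr0 mul0r expR0 mulr1.
move: x0d; rewrite ler_pdivlMr// mulrC => /(le_trans _); apply.
by rewrite ler_wpM2r ?sqrtr_ge0// /c lerDl.
Qed.

Lemma GUES_semicone : compact A -> compact A' -> GUES A -> GUES A'.
Proof.
move=> cA cA' /GUES_growth_bound [M [lam [M0 lam0 AM]]].
(* If [A'] contains 0, then [(l * lam)%:M] itself is dissipative with [l * lam] positive;
   homogeneity forces [V] to vanish, hence every vector too. *)
have [A'0|A'0] := pselect (A' 0).
  have V0 x : lyapunov A lam x = 0.
    have [l [C [l0 AC C0]]] := sub_convex_semicone A'0.
    have := dissipative_semicone M0 AM l0 AC; rewrite -C0 add0r => dl.
    have ll : 0 < l * lam by rewrite mulr_gt0.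
    apply/eqP; rewrite eq_le (lyapunov_ge0 AM) andbT -(pmulr_rle0 _ ll).
    apply/ler_addgt0Pl => e e0; rewrite addr0.
    have [r r0 /(_ (r / 2))] := dl x e e0.
    have r2 : 0 < r / 2 by lra.
    rewrite r2 => /(_ isT); rewrite (_ : r / 2 < r); last by lra.
    move=> /(_ isT).
    rewrite mul_scalar_mx scalerA -{1}[x]scale1r -scalerDl (lyapunovZ AM).
      rewrite mulrDl mul1r lerD2l -[leLHS]mulrA [leLHS]mulrC.
      by rewrite ler_pM2r.
    by rewrite addr_gt0// mulr_gt0.
  exists 1, 1; split => // x0 t a x _ _ _.
  have -> : enorm (x t) = 0.
    apply/eqP; rewrite eq_le sqrtr_ge0 andbT (le_trans (enorm_le_norm _))//.
    rewrite (_ : `|x t| = 0) ?mulr0//.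
    by apply/eqP; rewrite eq_le normr_ge0 andbT -(V0 (x t)) (norm_le_lyapunov AM).
  by rewrite mul1r mulr_ge0 ?expR_ge0 ?sqrtr_ge0.
(* [A'] is closed and misses 0, so it misses a ball around 0. *)
have [c c0 A'c] : exists2 c : R, 0 < c & forall B, A' B -> c <= `|B|.
  have : nbhs (0 : 'M[R]_n) (~` A').
    apply: open_nbhs_nbhs; split => //; apply: closed_openC.
    exact: compact_closed cA'.
  move=> /nbhs_ballP[c /= c0 Bc]; exists c => // B A'B.
  rewrite leNgt; apply/negP => Bltc; apply: Bc A'B.
  by rewrite -ball_normE /= sub0r normrN.
(* Balls are convex, so a bound on [A] passes to its hull. *)
have [K K0 AK] : exists2 K : R, 0 < K & forall B, convex_hull A B -> `|B| <= K.
  have [K [_ AK]] := compact_bounded cA.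
  pose K' := Num.max K 0 + 1.
  have KK' : K < K' by rewrite /K' (le_lt_trans (_ : _ <= Num.max K 0)) ?ltrDl// le_max lexx.
  have K'0 : 0 < K' by rewrite /K' ltr_wpDl// le_max lexx orbT.
  exists K' => // B; apply: (@smallest_sub _ (@convex_set R 'M[R]_n) A
    [set B | `|B| <= K']) => [|C AC]; last exact: AK.
  apply/convex_setW => C D; rewrite !inE/= => CK DK p p0 p1; rewrite inE/=.
  set q : R := p%:num in p0 p1.
  suff : `|q *: C + (1 - q) *: D| <= K' by [].
  rewrite (le_trans (ler_normD _ _))// !normrZ (gtr0_norm p0).
  rewrite (gtr0_norm (_ : 0 < 1 - q)) ?subr_gt0//.
  have : q * `|C| <= q * K' by rewrite ler_pM2l.
  have : (1 - q) * `|D| <= (1 - q) * K' by rewrite ler_pM2l// subr_gt0.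
  by move=> hD hC; rewrite (le_trans (lerD hC hD))// -mulrDl subrKC mul1r.
(* If [B = l *: C], then [c <= |B| = l * |C| <= l * K], so the rate [l * lam] is at least [k]. *)
pose k := c / K * lam.
have k0 : 0 < k by rewrite mulr_gt0// divr_gt0.
exists (n%:R * M + 1), k; split => //; first by rewrite ltr_wpDl// mulr_ge0.
move=> x0 t a x t0 sa solx.
have dA' B : A' B -> dissipative (lyapunov A lam) (B + k%:M).
  move=> A'B; have := sub_convex_semicone A'B => -[l [C [l0 AC BC]]].
  have := dissipative_semicone M0 AM l0 AC; rewrite -BC.
  apply: (dissipative_lower (lyapunovD AM) (lyapunovZ AM) (lyapunov_ge0 AM)).
  rewrite /k ler_pM2r// ler_pdivrMr// (le_trans (A'c _ A'B))// BC normrZ.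
  by rewrite gtr0_norm// ler_pM2l// AK.
rewrite (le_trans (solution_decay M0 AM (ltW k0) dA' sa solx (ltW t0)))//.
rewrite ler_wpM2r ?sqrtr_ge0// ler_wpM2r ?expR_ge0//.
by rewrite lerDl.
Qed.

End SameSemicone.

Theorem proposition1 (R : realType) (n : nat) (A A' : set 'M[R]_n)
    (cA : compact A) (cA' : compact A')
    (AA' : convex_semicone A = convex_semicone A') :
  (GUES A <-> GUES A') /\ (uniformly_stable A <-> uniformly_stable A').
Proof.
have A'A := esym AA'.
split; split.
- exact: GUES_semicone.
- exact: GUES_semicone.
- exact: uniformly_stable_semicone.
- exact: uniformly_stable_semicone.
Qed.
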